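(* Let $A$ and $B$ be two nontrivial linear subspaces of $\mathbb R^d$ (each $\neq\{0\}$ and $\neq\mathbb R^d$), with Friedrichs angle $\theta_F=\theta_F(A,B)$. For $a_0=x_0\in\mathbb R^d$ and $k=1,2,\ldots$ put $a_k:=(P_AP_B)^k(a_0)$ and $x_k:=\left(\frac{P_A+P_B}{2}\right)^k(x_0)$. If $\|a_1-P_{A\cap B}(a_0)\|>0$, put $$\lambda:=\lim_{k\to\infty}\frac{\|a_{k+1}-P_{A\cap B}(a_0)\|}{\|a_k-P_{A\cap B}(a_0)\|}\quad\text{and}\quad\mu:=\lim_{k\to\infty}\frac{\|x_{k+1}-P_{A\cap B}(x_0)\|}{\|x_k-P_{A\cap B}(x_0)\|}.$$ (i) Assume that $\theta_F>\frac\pi3$ (equivalently, $\cos(\theta_F)<\frac12$). Then for every starting point $a_0=x_0\in\mathbb R^d$ with $\|a_1-P_{A\cap B}(a_0)\|>0$ one has $$\mu\ \geq\ \tfrac12-\tfrac12\cos(\theta_F)\ >\ \cos^2(\theta_F)\ \geq\ \lambda .$$ In particular, there is $k_0$ such that $\|x_k-P_{A\cap B}(x_0)\|>\|a_k-P_{A\cap B}(a_0)\|$ for all $k\geq k_0$. (ii) Assume that $\theta_F<\frac\pi3$ (equivalently, $\cos(\theta_F)>\frac12$). Then the eigenspace $\mathcal N\big((\frac12-\frac12\cos(\theta_F))-\frac{P_A+P_B}{2}\big)$ contains nonzero vectors and, for any nonzero starting point $a_0=x_0=w$ in it, one has $\Lambda(x_0,\frac{P_A+P_B}{2})=\{\frac12-\frac12\cos(\theta_F)\}$,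 $\Lambda(a_0,P_BP_AP_B)=\{0,\cos^2(\theta_F)\}$, $$\mu=\tfrac12-\tfrac12\cos(\theta_F)<\cos^2(\theta_F)=\lambda,$$ and, for each $k=1,2,\ldots$, $$\|a_k-P_{A\cap B}(a_0)\|^2=\lambda^{2k-1}\mu\|w\|^2>\mu^{2k}\|w\|^2=\|x_k-P_{A\cap B}(x_0)\|^2.$$ If instead $\cos(\theta_F)=\frac12$, then for such starting points $\lambda=\mu$ and $\|a_k-P_{A\cap B}(a_0)\|=\|x_k-P_{A\cap B}(x_0)\|$ for each $k=1,2,\ldots$.
   Context: $\mathbb R^d$ is equipped with an arbitrary inner product $\langle\cdot,\cdot\rangle$ and the induced norm $\|\cdot\|$. For a subspace $M\subset\mathbb R^d$, $P_M$ denotes the orthogonal projection onto $M$. The Friedrichs angle $\theta_F=\theta_F(A,B)\in[0,\frac\pi2]$ is defined by $\cos(\theta_F)=\max\{\langle a,b\rangle: a\in A\cap(A\cap B)^\perp,\ b\in B\cap(A\cap B)^\perp,\ \|a\|\le1,\ \|b\|\leq1\}$. For a linear operator $T$ on $\mathbb R^d$, $\mathcal N(T)$ is its null space, $\lambda-T$ stands for $\lambda I-T$, $\Lambda(T):=\{\lambda\in\mathbb R:\mathcal N(\lambda-T)\neq\{0\}\}$ is the set of eigenvalues, and for $x\in\mathbb R^d$, $\Lambda(x,T):=\{\lambda\in\Lambda(T):P_{\mathcal N(\lambda-T)}(x)\neq0\}$. Under the assumption $\|a_1-P_{A\cap B}(a_0)\|>0$, all the error norms $\|a_k-P_{A\cap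 B}(a_0)\|$ and $\|x_k-P_{A\cap B}(x_0)\|$, $k\ge1$, are positive and both limits exist, with $\lambda=\max\{\Lambda(a_0,P_BP_AP_B)\setminus\{0,1\}\}$ and $\mu=\max\{\Lambda(x_0,\frac{P_A+P_B}{2})\setminus\{0,1\}\}$. *)

(* Defs.v *)
From HB Require Import structures.
From mathcomp Require Import all_boot all_order all_algebra sesquilinear.
From mathcomp Require Import all_classical all_reals all_analysis.
Set Implicit Arguments.
Unset Strict Implicit.
Unset Printing Implicit Defensive.
Import Order.TTheory GRing.Theory Num.Theory.
Import numFieldNormedType.Exports.
Local Open Scope classical_set_scope.
Local Open Scope ring_scope.

(* An inner product on R^d is a form [ip : {dot 'rV[R]_d for idfun}], i.e.
   a symmetric positive definite bilinear form.  The ambient sup-norm of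
   'rV[R]_d plays no role; the norm is [ipnorm ip]. *)
Definition ipnorm (R : realType) (d : nat) (ip : {dot 'rV[R]_d for idfun})
    (x : 'rV[R]_d) : R :=
  Num.sqrt (ip x x).

(* As ip is definite, M and its orthogonal complement are in direct sum and
   span the whole space, so that projecting along the latter is meaningful. *)
Definition oproj (R : realType) (d : nat) (ip : {dot 'rV[R]_d for idfun})
    (M : {vspace 'rV[R]_d}) : 'End('rV[R]_d) :=
  daddv_pi M (orthov ip M).

Definition friedrichs_set (R : realType) (d : nat)
    (ip : {dot 'rV[R]_d for idfun}) (A B : {vspace 'rV[R]_d}) : set R :=
  [set r | exists a b : 'rV[R]_d,
    [/\ a \in (A :&: orthov ip (A :&: B))%VS,
        b \in (B :&: orthov ip (A :&: B))%VS,
        ipnorm ip a <= 1, ipnorm ip b <= 1 & r = ip a b]].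

(* The angle in [0, pi/2] whose cosine is the maximum of [friedrichs_set].
   The maximum exists by compactness of unit balls and lies in [0, 1], so
   exactly one t satisfies the predicate. *)
Definition friedrichs_angle (R : realType) (d : nat)
    (ip : {dot 'rV[R]_d for idfun}) (A B : {vspace 'rV[R]_d}) : R :=
  get [set t : R | [/\ 0 <= t <= pi / 2,
                       friedrichs_set ip A B (cos t) &
                       ubound (friedrichs_set ip A B) (cos t)]].

(* The set Lambda(x, T).  The library's [leigenspace T l] is the null space of
   T - l, i.e. that of l - T. *)
Definition eigenvalues_at (R : realType) (d : nat)
    (ip : {dot 'rV[R]_d for idfun}) (x : 'rV[R]_d) (T : 'End('rV[R]_d)) :
    set R :=
  [set l | passmx.leigenvalue T l /\ oproj ip (passmx.leigenspace T l) x != 0].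

Definition avgproj (R : realType) (d : nat) (ip : {dot 'rV[R]_d for idfun})
    (A B : {vspace 'rV[R]_d}) : 'End('rV[R]_d) :=
  2^-1 *: (oproj ip A + oproj ip B).

(* Distances to P_{A :&: B} x of the k-th iterates, started at x, of P_A P_B
   and of (P_A + P_B) / 2. *)
Definition alt_err (R : realType) (d : nat) (ip : {dot 'rV[R]_d for idfun})
    (A B : {vspace 'rV[R]_d}) (x : 'rV[R]_d) (k : nat) : R :=
  ipnorm ip (iter k (oproj ip A \o oproj ip B)%VF x - oproj ip (A :&: B) x).

Definition avg_err (R : realType) (d : nat) (ip : {dot 'rV[R]_d for idfun})
    (A B : {vspace 'rV[R]_d}) (x : 'rV[R]_d) (k : nat) : R :=
  ipnorm ip (iter k (avgproj ip A B) x - oproj ip (A :&: B) x).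

Definition quotients (R : realType) (e : nat -> R) : nat -> R :=
  fun k => e k.+1 / e k.

(* Main.v *)
Require Import Defs.
From HB Require Import structures.
From mathcomp Require Import all_boot all_order all_algebra sesquilinear.
From mathcomp Require Import all_classical all_reals all_analysis.
From mathcomp Require Import ring lra.
Set Implicit Arguments.
Unset Strict Implicit.
Unset Printing Implicit Defensive.
Import Order.TTheory GRing.Theory Num.Theory.
Import numFieldNormedType.Exports.
Local Open Scope classical_set_scope.
Local Open Scope ring_scope.

(** Write [PA], [PB] for the projections, [T = (PA + PB) / 2], [c] for the
    cosine of the Friedrichs angle, and subtract from the starting point its
    projection onto [A :&: B]; the errors are then the norms of the iterates.

    Existence of the limits. [T] is self-adjoint, and [PA PB] coincides on [A]
    with the self-adjoint [PA PB PA]. For the iterates [z_k] of a self-adjoint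
    operator, [|z_{k+1}|^2 = <z_k, z_{k+2}> <= |z_k| |z_{k+2}|], so the quotients
    of consecutive errors are nondecreasing; being bounded they converge
    ([alt_err_logconvex], [avg_err_logconvex], [cvgn_quotients]).

    Large angles. Inside the complement of [A :&: B], each projection from one of
    the subspaces onto the other contracts by [c], so a step of [PA PB] contracts
    by [c ^+ 2] ([alt_err_le]). On sums of vectors of the two subspaces in this
    complement, [T] is bounded below by [(1 - c) / 2] ([avgproj_lower]), so the
    averaged iterates cannot decay faster ([avg_err_ge]). These bounds hold
    from the first iterate on, and [c ^+ 2 < (1 - c) / 2] is equivalent to
    [(2 c - 1) (c + 1) < 0]; the errors are then compared with geometric
    sequences ([geometric_lt]).

    Small angles. The maximum defining [c] exists by compactness
    ([friedrichs_max]), and a maximizing pair [(a, b)] satisfies [PB a = c b] and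
    [PA b = c a], so [a - b] is an eigenvector of [T] for [(1 - c) / 2]
    ([friedrichs_eigenvector]). For any such eigenvector [w] one has
    [PA (PB w) = - c PA w] and [PB (PA w) = - c PB w], whence
    [(PA PB)^(k+1) w = - c (c ^+ 2)^k PA w] with [|PA w|^2 = (1 - c) / 2 * |w|^2]
    ([iter_alt_eig], [sqr_ipnorm_oproj_eig]): both error sequences are explicit
    geometric sequences. *)

(** * Orthogonal projections for an inner product *)

Section InnerProduct.
Variables (R : realType) (d : nat) (ip : {dot 'rV[R]_d for idfun}).
Implicit Types (x y u v w : 'rV[R]_d) (M N A B : {vspace 'rV[R]_d}).

Local Notation "''[' u , v ]" := (ip u v).
Local Notation nrm := (ipnorm ip).

Lemma ipC u v : '[u, v] = '[v, u].
Proof. by have := hermC ip u v; rewrite expr0 mul1r. Qed.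

Lemma ipZl a u v : '[a *: u, v] = a * '[u, v].
Proof. exact: linearZl_LR. Qed.

Lemma ipZr a u v : '[u, a *: v] = a * '[u, v].
Proof. by rewrite ipC ipZl ipC. Qed.

Lemma ipDl u v w : '[u + v, w] = '[u, w] + '[v, w].
Proof. exact: linearDl. Qed.

Lemma ipDr u v w : '[w, u + v] = '[w, u] + '[w, v].
Proof. exact: linearDr. Qed.

Lemma ipNl u v : '[- u, v] = - '[u, v].
Proof. exact: linearNl. Qed.

Lemma ipBl u v w : '[u - v, w] = '[u, w] - '[v, w].
Proof. exact: linearBl. Qed.

Lemma ipBr u v w : '[w, u - v] = '[w, u] - '[w, v].
Proof. exact: linearBr. Qed.

Lemma ip0l u : '[0, u] = 0. Proof. exact: linear0l. Qed.

Lemma ip0r u : '[u, 0] = 0. Proof. exact: linear0r. Qed.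

Lemma ip_ge0 u : 0 <= '[u, u].
Proof.
have [->|u0] := eqVneq u 0; first by rewrite ip0l.
exact/ltW/neq0_dnorm_gt0.
Qed.

Lemma ip_eq0 u : ('[u, u] == 0) = (u == 0).
Proof.
have [->|u0] := eqVneq u 0; first by rewrite ip0l eqxx.
by rewrite gt_eqF// neq0_dnorm_gt0.
Qed.

Lemma ipnorm_ge0 u : 0 <= nrm u. Proof. exact: sqrtr_ge0. Qed.

Lemma sqr_ipnorm u : nrm u ^+ 2 = '[u, u].
Proof. by rewrite sqr_sqrtr// ip_ge0. Qed.

Lemma ipnorm_eq0 u : (nrm u == 0) = (u == 0).
Proof. by rewrite -sqrf_eq0 sqr_ipnorm ip_eq0. Qed.

Lemma ipnorm_gt0 u : (0 < nrm u) = (u != 0).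
Proof. by rewrite lt_def ipnorm_eq0 ipnorm_ge0 andbT. Qed.

Lemma ipnorm0 : nrm 0 = 0. Proof. by apply/eqP; rewrite ipnorm_eq0. Qed.

Lemma ipnormZ a u : nrm (a *: u) = `|a| * nrm u.
Proof. by rewrite /ipnorm ipZl ipZr mulrA -expr2 sqrtrM ?sqr_ge0// sqrtr_sqr. Qed.

Lemma ipnormN u : nrm (- u) = nrm u.
Proof. by rewrite -scaleN1r ipnormZ normrN1 mul1r. Qed.

Lemma ip_le u v : '[u, v] <= nrm u * nrm v.
Proof.
have [->|u0] := eqVneq u 0; first by rewrite ip0l ipnorm0 mul0r.
have [->|v0] := eqVneq v 0; first by rewrite ip0r ipnorm0 mulr0.
have := ip_ge0 (nrm v *: u - nrm u *: v).
rewrite ipBl !ipBr !(ipZl, ipZr) -!sqr_ipnorm (ipC v u).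
have : 0 < nrm u by rewrite ipnorm_gt0.
have : 0 < nrm v by rewrite ipnorm_gt0.
move: (nrm u) (nrm v) '[u, v] => a b z b0 a0 H.
have ab : 0 < 2 * (a * b) by rewrite !mulr_gt0.
rewrite -subr_ge0 -(pmulr_rge0 _ ab).
by apply: le_trans H _; rewrite le_eqVlt; apply/orP; left; apply/eqP; ring.
Qed.

Lemma orthov_memP M x :
  reflect (forall v, v \in M -> '[x, v] = 0) (x \in orthov ip M).
Proof. exact: mem_orthovP. Qed.

(** Each vector of [s] imposes one linear equation and so lowers the dimension by
    at most one; this makes orthogonal complements large enough. *)
Lemma dim_cap_orthov (W : {vspace 'rV[R]_d}) (s : seq 'rV[R]_d) :
  (\dim W <= \dim (W :&: orthov ip (span s)) + size s)%N.
Proof.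
elim: s => [|v s IH] /=; first by rewrite span_nil orthov0 capvf addn0.
have := leq_dim_orthov1 ip v (W :&: orthov ip (span s)).
set W1 := (W :&: _)%VS in IH *; set W2 := (W1 :&: _)%VS => H.
have W21 : (W2 <= W :&: orthov ip (span (v :: s)))%VS.
  apply/subvP => x /memv_capP[/memv_capP[xW /orthov_memP xs] /orthov_memP xv].
  rewrite memv_cap xW; apply/orthov_memP => y.
  rewrite span_cons => /memv_addP[a av [b bs ->]].
  by rewrite ipDr xv// xs// addr0.
apply: leq_trans IH _; rewrite addnS -addSn leq_add2r.
by rewrite (leq_trans (leqSpred _))// ltnS (leq_trans H)// dimvS.
Qed.

Lemma capv_orthov M : (M :&: orthov ip M = 0)%VS.
Proof.
apply/eqP; rewrite -subv0; apply/subvP => x /memv_capP[xM /orthov_memP xo].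
by rewrite memv0 -ip_eq0 xo.
Qed.

Lemma addv_orthov M : (M + orthov ip M)%VS = fullv.
Proof.
apply/eqP; rewrite eqEdim subvf/= dimv_disjoint_sum ?capv_orthov//.
have := dim_cap_orthov fullv (vbasis M); rewrite capfv size_tuple.
by rewrite (span_basis (vbasisP M)) addnC.
Qed.

Lemma oproj_in M x : oproj ip M x \in M. Proof. exact: memv_pi. Qed.

Lemma oproj_id M x : x \in M -> oproj ip M x = x.
Proof. by apply: daddv_pi_id; exact: capv_orthov. Qed.

Lemma oproj_idem M x : oproj ip M (oproj ip M x) = oproj ip M x.
Proof. exact/oproj_id/oproj_in. Qed.

Lemma oproj_orth M x v : v \in M -> '[x - oproj ip M x, v] = 0.
Proof.
move=> vM; have xM : x \in (M + orthov ip M)%VS by rewrite addv_orthov memvf.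
rewrite -{1}(daddv_pi_add (capv_orthov M) xM) addrC addKr.
by have /orthov_memP-> // := memv_pi (orthov ip M) M x.
Qed.

Lemma ip_oproj M x v : v \in M -> '[oproj ip M x, v] = '[x, v].
Proof. by move/(oproj_orth x)/eqP; rewrite ipBl subr_eq0 => /eqP. Qed.

Lemma oproj_sym M x y : '[oproj ip M x, y] = '[x, oproj ip M y].
Proof.
by rewrite -(ip_oproj x (oproj_in M y)) ipC -(ip_oproj y (oproj_in M x)) ipC.
Qed.

(** The working characterization of [oproj]; it turns every identification of a
    projection below into two membership checks. *)
Lemma oproj_uniq M x u : u \in M -> (forall v, v \in M -> '[x - u, v] = 0) ->
  oproj ip M x = u.
Proof.
move=> uM xu; apply/eqP; rewrite -subr_eq0 -ip_eq0.
have D : oproj ip M x - u \in M by rewrite memvB ?oproj_in.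
have E : oproj ip M x - u = (x - u) - (x - oproj ip M x).
  by rewrite opprB [RHS]addrC addrA subrK.
by rewrite {1}E ipBl xu// oproj_orth// subrr.
Qed.

Lemma sqr_ipnorm_oproj M x : nrm (oproj ip M x) ^+ 2 = '[x, oproj ip M x].
Proof. by rewrite sqr_ipnorm ip_oproj ?oproj_in. Qed.

Lemma ipnorm_oproj M x : nrm (oproj ip M x) <= nrm x.
Proof.
have := ip_le x (oproj ip M x); rewrite -sqr_ipnorm_oproj.
have := ipnorm_ge0 (oproj ip M x); have := ipnorm_ge0 x.
move: (nrm _) (nrm _) => a b a0 b0 H; nra.
Qed.

(** Projections onto larger subspaces preserve the complement of a common
    subspace, so that all iterates stay in the complement of [A :&: B]. *)
Lemma oproj_orthov M N x : (N <= M)%VS -> x \in orthov ip N ->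
  oproj ip M x \in (M :&: orthov ip N)%VS.
Proof.
move=> /subvP NM /orthov_memP xN; rewrite memv_cap oproj_in; apply/orthov_memP => v vN.
by rewrite ip_oproj ?NM// xN.
Qed.

Lemma sub_oproj_orthov N x : x - oproj ip N x \in orthov ip N.
Proof. by apply/orthov_memP => v vN; rewrite oproj_orth. Qed.

Lemma avgprojE A B x :
  avgproj ip A B x = 2^-1 *: (oproj ip A x + oproj ip B x).
Proof. by rewrite /avgproj scale_lfunE add_lfunE. Qed.

Lemma avgproj_sym A B x y : '[avgproj ip A B x, y] = '[x, avgproj ip A B y].
Proof. by rewrite !avgprojE ipZl ipZr ipDl ipDr !oproj_sym. Qed.

Lemma ipnormD u v : nrm (u + v) <= nrm u + nrm v.
Proof.
have := ip_le u v; have := ipnorm_ge0 u; have := ipnorm_ge0 v.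
have := ipnorm_ge0 (u + v).
have : nrm (u + v) ^+ 2 = nrm u ^+ 2 + nrm v ^+ 2 + 2 * '[u, v].
  by rewrite !sqr_ipnorm ipDl !ipDr (ipC v u); ring.
move: (nrm u) (nrm v) (nrm _) '[u, v] => a b c z E c0 b0 a0 H.
rewrite -ler_sqr ?nnegrE ?addr_ge0// E; nra.
Qed.

Lemma ipnorm_avgproj A B x : nrm (avgproj ip A B x) <= nrm x.
Proof.
rewrite avgprojE ipnormZ ger0_norm ?invr_ge0//.
have := ipnormD (oproj ip A x) (oproj ip B x).
have := ipnorm_oproj A x; have := ipnorm_oproj B x; lra.
Qed.

End InnerProduct.

(** * The Friedrichs angle *)

Section FriedrichsAngle.
Variables (R : realType) (d : nat) (ip : {dot 'rV[R]_d for idfun}).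
Implicit Types (x y u v w : 'rV[R]_d) (M N A B : {vspace 'rV[R]_d}).

Local Notation "''[' u , v ]" := (ip u v).
Local Notation nrm := (ipnorm ip).

(** In the coordinates of [x] the form is a quadratic polynomial; this is the only
    link between [ip] and the topology of the sup norm. *)
Lemma ip_lin_continuous (g : 'End('rV[R]_d)) :
  continuous (fun x => '[g x, g x]).
Proof.
pose e j : 'rV[R]_d := delta_mx 0 j.
have E x : '[g x, g x] =
    \sum_(i < d) \sum_(j < d) (x 0 i * x 0 j) * '[g (e i), g (e j)].
  rewrite [x in LHS]row_sum_delta linear_sum linear_sumlz; apply: eq_bigr => i _.
  rewrite linear_sumr; apply: eq_bigr => j _ /=.
  by rewrite ![g (_ *: _)]linearZ/= ipZl ipZr mulrA.
rewrite (funext E); apply: continuous_big => [|i _].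
  exact: add_continuous.
apply: continuous_big => [|j _]; first exact: add_continuous.
have c k : continuous (fun x : 'rV[R]_d => x 0 k) := @coord_continuous _ 1 d 0 k.
move=> x.
have cij := continuousM (c i x) (c j x).
exact: (continuousM cij (@cst_continuous _ _ '[g (e i), g (e j)] x)).
Qed.

(** The Rayleigh quotient of [g] is invariant under scaling, so it suffices to
    maximize it over the unit sphere of the sup norm, which is compact. This
    avoids comparing the two norms. *)
Lemma opnorm_attained (g : 'End('rV[R]_d)) w : w != 0 ->
  exists2 x, x != 0 & forall y, nrm (g y) * nrm x <= nrm (g x) * nrm y.
Proof.
move=> w0; pose S := [set x : 'rV[R]_d | `|x| = 1].
have S0 : S !=set0.
  exists (`|w|^-1 *: w); rewrite /S/= normrZ normfV normr_id mulVf//.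
  by rewrite normr_eq0.
have cS : compact S.
  apply: bounded_closed_compact.
    by exists 1; split; [exact: num_real|move=> M M1 x /= ->; exact: ltW].
  have /continuous_closedP := @norm_continuous _ 'rV[R]_d.
  by move=> /(_ [set 1]); apply; exact: closed_eq.
have SN x : S x -> x != 0.
  by rewrite /S/=; apply: contra_eq_neq => ->; rewrite normr0 eq_sym oner_neq0.
have [|x xS xmax] := @EVT_max_rV R d (fun x => '[g x, g x] / '[x, x]) S S0 cS.
  apply: continuous_in_subspaceT => x; rewrite inE => /SN x0.
  have := @ip_lin_continuous \1%VF.
  under eq_fun do rewrite id_lfunE.
  move=> c1; apply: (continuousM (@ip_lin_continuous g x)).
  by apply: continuousV (c1 x); rewrite ip_eq0.
rewrite inE in xS; have x0 := SN _ xS; exists x => // y.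
have [->|y0] := eqVneq y 0; first by rewrite linear0 ipnorm0 mul0r mulr0.
have := xmax (`|y|^-1 *: y); rewrite inE => H.
have {H} : '[g y, g y] / '[y, y] <= '[g x, g x] / '[x, x].
  have yn : `|y|^-1 != 0 by rewrite invr_eq0 normr_eq0.
  apply: le_trans (H _).
    rewrite linearZ/= !(ipZl, ipZr) !mulrA -expr2 -mulf_div divff ?mul1r//.
    by rewrite expf_neq0.
  by rewrite /S/= normrZ normfV normr_id mulVf// normr_eq0.
rewrite ler_pdivrMr ?neq0_dnorm_gt0// mulrAC ler_pdivlMr ?neq0_dnorm_gt0//.
by rewrite -!sqr_ipnorm -!exprMn ler_sqr ?nnegrE ?mulr_ge0 ?ipnorm_ge0.
Qed.

Lemma oproj_eq0 M x : x \in orthov ip M -> oproj ip M x = 0.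
Proof.
move=> /orthov_memP xM; apply: oproj_uniq => [|v vM]; first exact: mem0v.
by rewrite subr0 xM.
Qed.

Lemma ipnorm_sub_oproj M x : nrm (x - oproj ip M x) <= nrm x.
Proof.
have E : x - oproj ip M x = oproj ip (orthov ip M) x.
  symmetry; apply: oproj_uniq => [|v /orthov_memP vM]; first exact: sub_oproj_orthov.
  by rewrite subKr ipC vM// oproj_in.
by rewrite E ipnorm_oproj.
Qed.

(** With [PN] the projection onto [A :&: B], the maximum is the operator norm of
    [PB PA (1 - PN)]: on [A :&: orthov ip (A :&: B)] this operator is [PB], and
    by Cauchy-Schwarz the best [b] for a given [a] is a multiple of [PB a]. *)
Lemma friedrichs_max A B w : w != 0 ->
  exists r, [/\ 0 <= r <= 1, friedrichs_set ip A B r &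
                ubound (friedrichs_set ip A B) r].
Proof.
move=> w0; pose N := (A :&: B)%VS.
pose PA := oproj ip A; pose PB := oproj ip B; pose PN := oproj ip N.
pose g := (PB \o PA \o (\1 - PN))%VF.
have gE x : g x = PB (PA (x - PN x)).
  by rewrite /g !comp_lfunE add_lfunE opp_lfunE id_lfunE.
have [x x0 xmax] := opnorm_attained g w0.
have nx : 0 < nrm x by rewrite ipnorm_gt0.
pose a := PA (x - PN x).
have aA : a \in (A :&: orthov ip N)%VS.
  by apply: oproj_orthov; [exact: capvSl|exact: sub_oproj_orthov].
have bB : g x \in (B :&: orthov ip N)%VS.
  rewrite gE; apply: oproj_orthov; first exact: capvSr.
  by have /memv_capP[] := aA.
have an : nrm a <= nrm x.
  exact: le_trans (ipnorm_oproj _ _ _) (ipnorm_sub_oproj _ _).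
have gn : nrm (g x) <= nrm x.
  by rewrite gE; exact: le_trans (ipnorm_oproj _ _ _) an.
exists (nrm (g x) / nrm x); split.
- by rewrite divr_ge0 ?ipnorm_ge0//= ler_pdivrMr// mul1r.
- have [g0|g0] := eqVneq (nrm (g x)) 0.
    exists 0, 0; split; rewrite ?mem0v ?ipnorm0//.
    by rewrite g0 mul0r ip0l.
  exists ((nrm x)^-1 *: a), ((nrm (g x))^-1 *: g x); split.
  + exact: memvZ.
  + exact: memvZ.
  + by rewrite ipnormZ normfV (ger0_norm (ltW nx)) mulrC ler_pdivrMr// mul1r.
  + by rewrite ipnormZ normfV (ger0_norm (ipnorm_ge0 _ _)) mulVf.
  + rewrite ipZl ipZr (_ : '[a, g x] = nrm (g x) ^+ 2).
      by rewrite expr2 mulKf// mulrC.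
    by rewrite gE sqr_ipnorm_oproj.
- move=> _ [a' [b' [/memv_capP[a'A a'N] /memv_capP[b'B b'N] a'1 b'1 ->]]].
  have -> : '[a', b'] = '[g a', b'].
    rewrite gE (_ : PN a' = 0); last exact: oproj_eq0.
    by rewrite subr0 [PA _]oproj_id// ip_oproj.
  apply: le_trans (ip_le _ _ _) _.
  apply: (@le_trans _ _ (nrm (g a') * 1)); first exact/ler_wpM2l/b'1/ipnorm_ge0.
  rewrite mulr1 ler_pdivlMr// (le_trans (xmax _))//.
  by rewrite -[leRHS]mulr1; exact/ler_wpM2l/a'1/ipnorm_ge0.
Qed.

Lemma friedrichs_angleP A B w (t := friedrichs_angle ip A B) : w != 0 ->
  [/\ 0 <= t <= pi / 2, friedrichs_set ip A B (cos t) &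
      ubound (friedrichs_set ip A B) (cos t)].
Proof.
move=> w0; have [r [/andP[r0 r1] rS rU]] := friedrichs_max A B w0.
have rI : -1 <= r <= 1 by rewrite r1 andbT (le_trans _ r0)// lerN10.
have [/andP[t0 tpi] tr] := acos_def rI.
suff : exists s, [/\ 0 <= s <= pi / 2, friedrichs_set ip A B (cos s) &
                     ubound (friedrichs_set ip A B) (cos s)] by move/getPex.
exists (acos r).
rewrite tr t0; split => //=; rewrite leNgt; apply/negP.
have p0 := @pi_gt0 R.
rewrite -ltr_cos ?in_itv/= ?t0 ?tpi//; last by apply/andP; split; lra.
by rewrite tr cos_pihalf ltNge r0.
Qed.

(** As [2 (pi / 3) = pi - pi / 3], the cosine is a root of
    [2 c ^+ 2 + c - 1 = (2 c - 1) (c + 1)], and it is positive. *)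
Lemma cos_pi3 : cos (pi / 3) = 1 / 2 :> R.
Proof.
have p0 := @pi_gt0 R; set t := pi / 3.
have : cos (t + t) = cos (pi - t) by congr cos; rewrite /t; field.
rewrite cosB cospi sinpi cosD -!expr2.
have := cos2Dsin2 t.
have : 0 < cos t by apply: cos_gt0_pihalf; apply/andP; rewrite /t; split; lra.
move: (cos t) (sin t) => c s c0 E1 E2.
have : (2 * c - 1) * (c + 1) = 0 by move: E1 E2; nra.
move/eqP; rewrite mulf_eq0 => /orP[/eqP|/eqP]; lra.
Qed.

Lemma cos_lt_half (t : R) : 0 <= t <= pi / 2 ->
  ((pi / 3 < t) = (cos t < 1 / 2)) /\ ((t < pi / 3) = (1 / 2 < cos t)).
Proof.
move=> /andP[t0 t1]; have p0 := @pi_gt0 R.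
by rewrite -cos_pi3 !ltr_cos ?in_itv//=; apply/andP; split; lra.
Qed.

(** The homogeneous form of an upper bound of [friedrichs_set], in which the
    vectors need not lie in the unit ball. *)
Definition cosine_bound A B (c : R) := forall a b,
  a \in (A :&: orthov ip (A :&: B))%VS ->
  b \in (B :&: orthov ip (A :&: B))%VS -> '[a, b] <= c * (nrm a * nrm b).

Lemma cosine_boundC A B c : cosine_bound A B c -> cosine_bound B A c.
Proof.
move=> H b a; rewrite (capvC B A) => bB aA.
by rewrite ipC [X in _ * X]mulrC; exact: H.
Qed.

Lemma friedrichs_cosine_bound A B c : ubound (friedrichs_set ip A B) c ->
  cosine_bound A B c.
Proof.
move=> cU a b aA bB.
have [->|a0] := eqVneq a 0; first by rewrite ip0l ipnorm0 mul0r mulr0.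
have [->|b0] := eqVneq b 0; first by rewrite ip0r ipnorm0 !mulr0.
have na : 0 < nrm a by rewrite ipnorm_gt0.
have nb : 0 < nrm b by rewrite ipnorm_gt0.
have : '[(nrm a)^-1 *: a, (nrm b)^-1 *: b] <= c.
  apply: cU; eexists; eexists; split; last reflexivity.
  - exact: memvZ.
  - exact: memvZ.
  - by rewrite ipnormZ normfV (ger0_norm (ltW na)) mulVf// gt_eqF.
  - by rewrite ipnormZ normfV (ger0_norm (ltW nb)) mulVf// gt_eqF.
by rewrite ipZl ipZr mulrA -invfM mulrC ler_pdivrMr// mulr_gt0.
Qed.

(** [PB a] is itself admissible as [b], and [<a, PB a> = |PB a|^2]. *)
Lemma cosine_bound_oproj A B c a : 0 <= c -> cosine_bound A B c ->
  a \in (A :&: orthov ip (A :&: B))%VS -> nrm (oproj ip B a) <= c * nrm a.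
Proof.
move=> c0 cb aA.
have bB : oproj ip B a \in (B :&: orthov ip (A :&: B))%VS.
  by apply: oproj_orthov; [exact: capvSr|have /memv_capP[] := aA].
have := cb _ _ aA bB; rewrite -sqr_ipnorm_oproj mulrA expr2.
have [->|b0] := eqVneq (oproj ip B a) 0.
  by rewrite ipnorm0 mulr_ge0// ipnorm_ge0.
by rewrite ler_pM2r// ipnorm_gt0.
Qed.

End FriedrichsAngle.

(** * Quotients of log-convex sequences *)

Section Quotients.
Variable R : realType.
Implicit Types e f : nat -> R.

(** Log-convexity makes the quotients nondecreasing, and [M] bounds them. This
    gives the existence of the limits without a spectral theorem. The indices
    start at 1 because an alternating iterate lies in [A] only from then on. *)
Lemma cvgn_quotients e (M : R) : (forall k, 0 < e k.+1) ->
  (forall k, e k.+2 ^+ 2 <= e k.+1 * e k.+3) ->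
  (forall k, e k.+2 <= M * e k.+1) -> cvgn (quotients e).
Proof.
move=> e0 elog eM.
have : cvgn [sequence quotients e n.+1]_n.
  apply: nondecreasing_is_cvgn.
    apply/nondecreasing_seqP => k; rewrite /quotients.
    rewrite ler_pdivrMr// mulrAC ler_pdivlMr// -expr2.
    by rewrite (le_trans (elog k))// mulrC.
  exists M => _ [k _ <-]; rewrite /quotients ler_pdivrMr//.
by case/cvg_ex => /= l; rewrite cvg_shiftS => el; apply/cvg_ex; exists l.
Qed.

Lemma limn_quotients_le e (p : R) : (forall k, 0 < e k.+1) ->
  (forall k, e k.+2 <= p * e k.+1) -> cvgn (quotients e) ->
  limn (quotients e) <= p.
Proof.
move=> e0 ep ecvg; apply: limr_le => //; exists 1%N => // -[|k] //= _.
by rewrite /quotients ler_pdivrMr.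
Qed.

Lemma limn_quotients_ge e (q : R) : (forall k, 0 < e k.+1) ->
  (forall k, q * e k.+1 <= e k.+2) -> cvgn (quotients e) ->
  q <= limn (quotients e).
Proof.
move=> e0 eq ecvg; apply: limr_ge => //; exists 1%N => // -[|k] //= _.
by rewrite /quotients ler_pdivlMr.
Qed.

Lemma limn_quotients_cst e (q : R) : (forall k, 0 < e k.+1) ->
  (forall k, e k.+2 = q * e k.+1) -> limn (quotients e) = q.
Proof.
move=> e0 eq; apply/cvg_lim => //; rewrite -cvg_shiftS.
rewrite (_ : [sequence _]_n = cst q); first exact: cvg_cst.
by apply/funext => k; rewrite /quotients /= eq mulfK// gt_eqF.
Qed.

Lemma geometric_lt e f (p q : R) : 0 <= p < q ->
  (forall k, f k.+2 <= p * f k.+1) -> (forall k, q * e k.+1 <= e k.+2) ->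
  0 < e 1%N -> exists k0, forall k, (k0 <= k)%N -> f k < e k.
Proof.
move=> /andP[p0 pq] fp eq e1; have q0 : 0 < q := le_lt_trans p0 pq.
have fk k : f k.+1 <= p ^+ k * f 1%N.
  elim: k => [|k IH]; first by rewrite expr0 mul1r.
  by rewrite (le_trans (fp k))// exprS -mulrA ler_wpM2l.
have ek k : q ^+ k * e 1%N <= e k.+1.
  elim: k => [|k IH]; first by rewrite expr0 mul1r.
  by rewrite (le_trans _ (eq k))// exprS -mulrA ler_pM2l.
have r1 : `|p / q| < 1.
  by rewrite ger0_norm ?divr_ge0 ?(ltW q0)// ltr_pdivrMr// mul1r.
have /cvgr_lt/(_ _ e1)[K _ HK] := cvg_geometric (f 1%N) r1.
exists K.+1 => -[|k]//; rewrite ltnS => /HK /=.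
rewrite expr_div_n mulrA ltr_pdivrMr ?exprn_gt0// => H.
by rewrite (le_lt_trans (fk k))// (lt_le_trans _ (ek k))// mulrC [ltRHS]mulrC.
Qed.

End Quotients.

(** * Rates of alternating and averaged projections *)

Section Rates.
Variables (R : realType) (d : nat) (ip : {dot 'rV[R]_d for idfun}).
Variables (A B : {vspace 'rV[R]_d}).
Implicit Types (x y u v w : 'rV[R]_d).

Local Notation "''[' u , v ]" := (ip u v).
Local Notation nrm := (ipnorm ip).
Local Notation N := (A :&: B)%VS.
Local Notation PA := (oproj ip A).
Local Notation PB := (oproj ip B).
Local Notation PN := (oproj ip N).
Local Notation T := (avgproj ip A B).
Local Notation U := (PA \o PB)%VF.
Local Notation altz x k := (iter k U (x - PN x)).
Local Notation avgz x k := (iter k T (x - PN x)).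

Lemma iter_subl (f : 'End('rV[R]_d)) x n k : f n = n ->
  iter k f x - n = iter k f (x - n).
Proof. by move=> fn; elim: k => //= k <-; rewrite linearB/= fn. Qed.

Lemma alt_errE x k : alt_err ip A B x k = nrm (altz x k).
Proof.
rewrite /alt_err iter_subl// comp_lfunE.
have /memv_capP[xA xB] := oproj_in ip N x.
by rewrite !(oproj_id ip xA, oproj_id ip xB).
Qed.

Lemma avg_errE x k : avg_err ip A B x k = nrm (avgz x k).
Proof.
rewrite /avg_err iter_subl// avgprojE.
have /memv_capP[xA xB] := oproj_in ip N x.
rewrite (oproj_id ip xA) (oproj_id ip xB).
by rewrite scalerDr -scalerDl (_ : 2^-1 + 2^-1 = 1 :> R) ?scale1r//; field.
Qed.

Lemma alt_orthov z : z \in orthov ip N -> U z \in (A :&: orthov ip N)%VS.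
Proof.
move=> zN; rewrite comp_lfunE; apply: oproj_orthov; first exact: capvSl.
by have /memv_capP[] := oproj_orthov (capvSr A B) zN.
Qed.

Lemma altzS_in x k : altz x k.+1 \in (A :&: orthov ip N)%VS.
Proof.
elim: k => [|k IH]; first exact/alt_orthov/sub_oproj_orthov.
by rewrite iterS; apply: alt_orthov; have /memv_capP[] := IH.
Qed.

(** On [A], [PA PB] agrees with the self-adjoint operator [PA PB PA]. *)
Lemma alt_sym u v : u \in A -> v \in A -> '[U u, v] = '[u, U v].
Proof.
move=> uA vA; rewrite !comp_lfunE oproj_sym (oproj_id ip vA) oproj_sym.
by rewrite -[RHS]oproj_sym (oproj_id ip uA).
Qed.

(** For [y] the vector [U z] of [A], [<y, U y> = |PB y|^2] and [|y|^2 = <z, PB y>]. *)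
Lemma alt_eq0 z : U (U z) = 0 -> U z = 0.
Proof.
rewrite !comp_lfunE; set y := PA (PB z) => H.
have yA : PA y = y by rewrite oproj_idem.
have PBy : PB y = 0.
  apply/eqP; rewrite -(ipnorm_eq0 ip) -sqrf_eq0 sqr_ipnorm_oproj -{1}yA.
  by rewrite oproj_sym H ip0r.
by apply/eqP; rewrite -(ip_eq0 ip) {1}/y oproj_sym yA oproj_sym PBy ip0r.
Qed.

Lemma alt_err_gt0 x k : 0 < alt_err ip A B x 1%N -> 0 < alt_err ip A B x k.+1.
Proof.
rewrite !alt_errE !ipnorm_gt0 => z1; elim: k => // k.
by apply: contraNneq => /alt_eq0/eqP.
Qed.

Lemma avg_eq0 z : T (T z) = 0 -> T z = 0.
Proof. by move=> H; apply/eqP; rewrite -(ip_eq0 ip) avgproj_sym H ip0r. Qed.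

(** [T] is the mean of two positive operators, so [T z = 0] forces [PB z = 0].
    After the first step self-adjointness excludes that an iterate vanishes. *)
Lemma avg_err_gt0 x k : 0 < alt_err ip A B x 1%N -> 0 < avg_err ip A B x k.+1.
Proof.
rewrite alt_errE avg_errE !ipnorm_gt0 => z1; elim: k => [|k]; last first.
  by apply: contraNneq => /avg_eq0/eqP.
move: z1 => /=; set z := x - _; apply: contraNneq => Tz0.
rewrite comp_lfunE; suff -> : PB z = 0 by rewrite linear0.
have : '[z, T z] = 0 by rewrite Tz0 ip0r.
rewrite avgprojE ipZr ipDr -!sqr_ipnorm_oproj => /eqP.
rewrite mulf_eq0 invr_eq0 pnatr_eq0/= paddr_eq0 ?sqr_ge0//.
by rewrite !sqrf_eq0 !ipnorm_eq0 => /andP[_ /eqP].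
Qed.

(** The square of the middle error is the inner product of its two neighbours,
    because one application of the operator can be moved across; then
    Cauchy-Schwarz. From the first iterate on one is in [A], where [PA PB] is
    self-adjoint. *)
Lemma alt_err_logconvex x k : alt_err ip A B x k.+2 ^+ 2 <=
  alt_err ip A B x k.+1 * alt_err ip A B x k.+3.
Proof.
rewrite !alt_errE sqr_ipnorm {1}iterS alt_sym; first exact: ip_le.
- by have /memv_capP[] := altzS_in x k.
- by have /memv_capP[] := altzS_in x k.+1.
Qed.

Lemma avg_err_logconvex x k : avg_err ip A B x k.+2 ^+ 2 <=
  avg_err ip A B x k.+1 * avg_err ip A B x k.+3.
Proof. rewrite !avg_errE sqr_ipnorm {1}iterS avgproj_sym; exact: ip_le. Qed.

Lemma cvgn_alt_quotients x : 0 < alt_err ip A B x 1%N ->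
  cvgn (quotients (alt_err ip A B x)).
Proof.
move=> x0; apply: (@cvgn_quotients _ _ 1) => k.
- exact: alt_err_gt0.
- exact: alt_err_logconvex.
- rewrite !alt_errE mul1r iterS comp_lfunE.
  exact: le_trans (ipnorm_oproj _ _ _) (ipnorm_oproj _ _ _).
Qed.

Lemma cvgn_avg_quotients x : 0 < alt_err ip A B x 1%N ->
  cvgn (quotients (avg_err ip A B x)).
Proof.
move=> x0; apply: (@cvgn_quotients _ _ 1) => k.
- exact: avg_err_gt0.
- exact: avg_err_logconvex.
- by rewrite !avg_errE mul1r iterS ipnorm_avgproj.
Qed.

Variable c : R.
Hypothesis c_ge0 : 0 <= c.
Hypothesis c_bound : cosine_bound ip A B c.

(** Both projections in one step contract by [c], the first one from [A] to [B]
    and the second one back. *)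
Lemma alt_err_le x k :
  alt_err ip A B x k.+2 <= c ^+ 2 * alt_err ip A B x k.+1.
Proof.
rewrite !alt_errE iterS comp_lfunE.
have zA := altzS_in x k; set z := iter k.+1 _ _ in zA *.
have PBz : PB z \in (B :&: orthov ip (B :&: A))%VS.
  rewrite (capvC B A); apply: oproj_orthov; first exact: capvSr.
  by have /memv_capP[] := zA.
rewrite (le_trans (cosine_bound_oproj c_ge0 (cosine_boundC c_bound) PBz))//.
by rewrite expr2 -mulrA ler_wpM2l// (cosine_bound_oproj c_ge0 c_bound zA).
Qed.

Hypothesis c_lt1 : c < 1.

(** The nonzero part of the spectrum of [T] on [orthov ip (A :&: B)] lies above
    [(1 - c) / 2]. Writing [z = u + v], Cauchy-Schwarz bounds [|z|^2] by
    [(|PA z|^2 + |PB z|^2)^(1/2) (|u|^2 + |v|^2)^(1/2)]. The first sum is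
    [2 <z, T z>], and the angle bound gives [(1 - c) (|u|^2 + |v|^2) <= |z|^2].
    Hence [(1 - c) / 2 * |z|^2 <= <z, T z>]. *)
Lemma avgproj_lower z u v : u \in (A :&: orthov ip N)%VS ->
  v \in (B :&: orthov ip N)%VS -> z = u + v ->
  (1 / 2 - 1 / 2 * c) * nrm z <= nrm (T z).
Proof.
move=> uA vB zE.
have /memv_capP[uA' _] := uA; have /memv_capP[vB' _] := vB.
have [->|z0] := eqVneq z 0; first by rewrite linear0 ipnorm0 mulr0.
have nz : 0 < nrm z by rewrite ipnorm_gt0.
(* Pairing [z = u + v] with [z]: each summand only sees its own projection. *)
have Z1 : nrm z ^+ 2 <= nrm (PA z) * nrm u + nrm (PB z) * nrm v.
  rewrite sqr_ipnorm {2}zE ipDr -(ip_oproj ip z uA') -(ip_oproj ip z vB').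
  by rewrite lerD ?ip_le.
(* The angle bound is applied to [- u] and [v]; then
   [2 |u| |v| <= |u|^2 + |v|^2]. *)
have Z2 : (1 - c) * (nrm u ^+ 2 + nrm v ^+ 2) <= nrm z ^+ 2.
  have := c_bound (rpredNr uA) vB.
  rewrite ipNl ipnormN zE !sqr_ipnorm ipDl !ipDr (ipC ip v u) -!sqr_ipnorm.
  have : 0 <= c * (nrm u - nrm v) ^+ 2 by rewrite mulr_ge0// sqr_ge0.
  nra.
have Z3 : nrm (PA z) ^+ 2 + nrm (PB z) ^+ 2 = 2 * '[z, T z].
  by rewrite avgprojE ipZr ipDr -!sqr_ipnorm_oproj mulrA divff// mul1r.
have Z4 := ip_le ip z (T z).
have cs : (nrm (PA z) * nrm u + nrm (PB z) * nrm v) ^+ 2 <=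
    (nrm (PA z) ^+ 2 + nrm (PB z) ^+ 2) * (nrm u ^+ 2 + nrm v ^+ 2).
  have := sqr_ge0 (nrm (PA z) * nrm v - nrm (PB z) * nrm u); nra.
move: Z1 Z2 Z3 Z4 cs.
set s := nrm u ^+ 2 + _; set pq := nrm (PA z) ^+ 2 + _.
set m := nrm (PA z) * _ + _ => Z1 Z2 Z3 Z4 cs.
have pq0 : 0 <= pq by rewrite addr_ge0 ?sqr_ge0.
have c1 : 0 <= 1 - c by rewrite subr_ge0 ltW.
have H1 : (nrm z ^+ 2) ^+ 2 <= pq * s.
  apply: le_trans cs; rewrite ler_sqr// ?nnegrE ?sqr_ge0//.
  exact: le_trans (sqr_ge0 _) Z1.
have H2 : (1 - c) * (nrm z ^+ 2) ^+ 2 <= pq * nrm z ^+ 2.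
  apply: le_trans (ler_wpM2l c1 H1) _.
  by rewrite mulrCA ler_wpM2l.
have H3 : (1 - c) * nrm z ^+ 2 <= pq.
  by rewrite -(@ler_pM2r _ (nrm z ^+ 2)) ?exprn_gt0// -mulrA -expr2.
rewrite -(ler_pM2l nz); move: H3 Z4; rewrite Z3.
set t := '[_, _]; set n := nrm (T z); move=> H3 Z4; nra.
Qed.

(** Every iterate after the first step lies in the range of [T], hence is a sum of
    a vector of [A] and a vector of [B]. *)
Lemma avg_err_ge x k :
  (1 / 2 - 1 / 2 * c) * avg_err ip A B x k.+1 <= avg_err ip A B x k.+2.
Proof.
rewrite !avg_errE [iter k.+2 _ _]iterS.
have zN : avgz x k \in orthov ip N.
  elim: k => [|k IH]; first exact: sub_oproj_orthov.
  have /memv_capP[_ ?] := oproj_orthov (capvSl A B) IH.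
  have /memv_capP[_ ?] := oproj_orthov (capvSr A B) IH.
  by rewrite iterS avgprojE memvZ// memvD.
apply: (@avgproj_lower _ (2^-1 *: PA (avgz x k)) (2^-1 *: PB (avgz x k))).
- exact/memvZ/(oproj_orthov (capvSl A B) zN).
- exact/memvZ/(oproj_orthov (capvSr A B) zN).
- by rewrite iterS avgprojE scalerDr.
Qed.

End Rates.

(** * Components along eigenspaces of a self-adjoint operator *)

Section Eigenvectors.
Variables (R : realType) (d : nat) (ip : {dot 'rV[R]_d for idfun}).
Implicit Types (x y u v w : 'rV[R]_d) (A B : {vspace 'rV[R]_d}).
Implicit Types (f : 'End('rV[R]_d)).

Local Notation "''[' u , v ]" := (ip u v).
Local Notation nrm := (ipnorm ip).

Lemma mem_leigenspace f l x :
  (x \in passmx.leigenspace f l) = (f x == l *: x).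
Proof.
by rewrite memv_ker add_lfunE opp_lfunE scale_lfunE id_lfunE subr_eq0.
Qed.

Lemma leigenspace_orth f a b u v : (forall x y, '[f x, y] = '[x, f y]) ->
  f u = a *: u -> f v = b *: v -> a != b -> '[u, v] = 0.
Proof.
move=> fs fu fv ab; have := fs u v; rewrite fu fv ipZl ipZr => /eqP.
by rewrite -subr_eq0 -mulrBl mulf_eq0 subr_eq0 (negbTE ab) => /eqP.
Qed.

(** Eigenspaces of a self-adjoint operator are orthogonal, so [u] and [v] are the
    components of [u + v] along the eigenspaces of [a] and [b], and all other
    components vanish. *)
Lemma eigenvalues_at2 f a b u v : (forall x y, '[f x, y] = '[x, f y]) ->
  a != b -> f u = a *: u -> f v = b *: v -> u != 0 -> v != 0 ->
  eigenvalues_at ip (u + v) f = [set a; b].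
Proof.
move=> fs ab fu fv u0 v0.
have lev l x : f x = l *: x -> x != 0 -> passmx.leigenvalue f l.
  move=> fx x0; apply/eqP => /vspaceP/(_ x).
  by rewrite mem_leigenspace fx eqxx memv0 (negbTE x0).
have pr l x y : f x = l *: x ->
    (forall z, f z = l *: z -> '[y, z] = 0) ->
    oproj ip (passmx.leigenspace f l) (x + y) = x.
  move=> fx yz; apply: oproj_uniq; first by rewrite mem_leigenspace fx.
  by move=> z; rewrite mem_leigenspace addrC addKr => /eqP; exact: yz.
have ba : b != a by rewrite eq_sym.
apply/seteqP; split => l /=; last first.
  case=> ->; split.
  - exact: lev fu u0.
  - by rewrite pr// => z fz; exact: (leigenspace_orth fs fv fz ba).
  - exact: lev fv v0.
  - by rewrite addrC pr// => z fz; exact: (leigenspace_orth fs fu fz ab).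
move=> [_]; have [->|la] := eqVneq l a; first by left.
have [->|lb] := eqVneq l b; first by right.
rewrite -[u + v]add0r pr ?eqxx ?linear0 ?scaler0// => z fz.
rewrite ipDl (leigenspace_orth fs fu fz) 1?eq_sym//.
by rewrite (leigenspace_orth fs fv fz) 1?eq_sym// addr0.
Qed.

Lemma eigenvalues_at1 f a u : (forall x y, '[f x, y] = '[x, f y]) ->
  f u = a *: u -> u != 0 -> eigenvalues_at ip u f = [set a].
Proof.
move=> fs fu u0; apply/seteqP; split => l /=; last first.
  move=> ->; split.
    apply/eqP => /vspaceP/(_ u).
    by rewrite mem_leigenspace fu eqxx memv0 (negbTE u0).
  by rewrite oproj_id// mem_leigenspace fu.
move=> [_]; have [//|la] := eqVneq l a.
rewrite oproj_eq0 ?eqxx//; apply/orthov_memP => v.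
rewrite mem_leigenspace => /eqP fv; apply: (leigenspace_orth fs fu fv).
by rewrite eq_sym.
Qed.

End Eigenvectors.

(** * The eigenvectors that slow alternating projections down *)

Section LeastEigenvalue.
Variables (R : realType) (d : nat) (ip : {dot 'rV[R]_d for idfun}).
Implicit Types (x y u v w : 'rV[R]_d) (A B : {vspace 'rV[R]_d}).

Local Notation "''[' u , v ]" := (ip u v).
Local Notation nrm := (ipnorm ip).

Lemma orthov_cap_disjoint A B a :
  a \in (A :&: orthov ip (A :&: B))%VS -> a \in (B :&: orthov ip (A :&: B))%VS ->
  a = 0.
Proof.
move=> /memv_capP[aA /orthov_memP aN] /memv_capP[aB _].
by apply/eqP; rewrite -(ip_eq0 ip) aN// memv_cap aA.
Qed.

(** Equality in Cauchy-Schwarz: expanding [|PB a - c b|^2] with [|PB a| <= c],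
    [|b| <= 1] and [<PB a, b> = c] gives a nonpositive number. *)
Lemma oproj_cosine_attained A B c a b : 0 <= c -> cosine_bound ip A B c ->
  a \in (A :&: orthov ip (A :&: B))%VS -> b \in B -> nrm a <= 1 -> nrm b <= 1 ->
  '[a, b] = c -> oproj ip B a = c *: b.
Proof.
move=> c0 cb aA bB a1 b1 abc.
have H := cosine_bound_oproj c0 cb aA.
have H1 : nrm (oproj ip B a) ^+ 2 <= c ^+ 2.
  rewrite ler_sqr ?nnegrE ?ipnorm_ge0// (le_trans H)//.
  by rewrite -[leRHS]mulr1 ler_wpM2l.
have H2 : nrm b ^+ 2 <= 1 by rewrite expr_le1// ipnorm_ge0.
apply/eqP; rewrite -subr_eq0 -(ipnorm_eq0 ip) -sqrf_eq0.
apply/eqP/le_anti; rewrite sqr_ge0 andbT.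
have pb : '[oproj ip B a, b] = c by rewrite ip_oproj.
rewrite sqr_ipnorm ipBl !ipBr !(ipZl, ipZr) (ipC ip b (oproj _ _ _)) pb -!sqr_ipnorm.
have : c ^+ 2 * nrm b ^+ 2 <= c ^+ 2 by rewrite -[leRHS]mulr1 ler_wpM2l// sqr_ge0.
nra.
Qed.

(** Cosine one would be attained by equal vectors, which lie in [A :&: B] and in
    its complement. *)
Lemma friedrichs_neq1 A B c : friedrichs_set ip A B c -> c != 1.
Proof.
move=> [a [b [aA bB a1 b1 ->]]]; apply/eqP => ab1.
have a2 : nrm a ^+ 2 <= 1 by rewrite expr_le1// ipnorm_ge0.
have b2 : nrm b ^+ 2 <= 1 by rewrite expr_le1// ipnorm_ge0.
have : nrm (a - b) ^+ 2 == 0.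
  apply/eqP/le_anti; rewrite sqr_ge0 andbT.
  by rewrite sqr_ipnorm ipBl !ipBr (ipC ip b a) ab1 -!sqr_ipnorm; lra.
rewrite sqrf_eq0 ipnorm_eq0 subr_eq0 => /eqP abE.
rewrite -abE in bB; move: ab1; rewrite (orthov_cap_disjoint aA bB) ip0l => /eqP.
by rewrite eq_sym oner_eq0.
Qed.

(** A maximizing pair satisfies [PB a = c b] and [PA b = c a], so that [T] scales
    [a - b] by [(1 - c) / 2]. *)
Lemma friedrichs_eigenvector A B c : 0 < c -> friedrichs_set ip A B c ->
  cosine_bound ip A B c ->
  exists w, w \in passmx.leigenspace (avgproj ip A B) (1 / 2 - 1 / 2 * c) /\
            w != 0.
Proof.
move=> c0 [a [b [aA bB a1 b1 cE]]] cb.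
have /memv_capP[aA' _] := aA; have /memv_capP[bB' _] := bB.
have PBa := oproj_cosine_attained (ltW c0) cb aA bB' a1 b1 (esym cE).
have PAb : oproj ip A b = c *: a.
  apply: (oproj_cosine_attained (ltW c0) (cosine_boundC cb)) => //.
    by rewrite (capvC B A).
  by rewrite ipC.
exists (a - b); split.
  rewrite mem_leigenspace avgprojE !linearB/= PBa PAb !oproj_id//.
  apply/eqP; rewrite (_ : a - c *: a = (1 - c) *: a); last first.
    by rewrite scalerBl scale1r.
  rewrite (_ : c *: b - b = - ((1 - c) *: b)); last first.
    by rewrite scalerBl scale1r opprB.
  by rewrite -!scalerBr scalerA; congr (_ *: _); field.
rewrite subr_eq0; apply/eqP => abE; rewrite -abE in bB.
by move: c0; rewrite cE (orthov_cap_disjoint aA bB) ip0l ltxx.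
Qed.

Variables (A B : {vspace 'rV[R]_d}) (c : R) (w : 'rV[R]_d).
Hypothesis c01 : 0 < c < 1.
Local Notation PA := (oproj ip A).
Local Notation PB := (oproj ip B).
Local Notation T := (avgproj ip A B).
Local Notation U := (PA \o PB)%VF.
Local Notation S := (PB \o PA \o PB)%VF.
Local Notation mu := (1 / 2 - 1 / 2 * c).
Hypothesis wE : w \in passmx.leigenspace T mu.
Hypothesis w0 : w != 0.

Let c_gt0 : 0 < c. Proof. by case/andP: c01. Qed.
Let c_lt1 : c < 1. Proof. by case/andP: c01. Qed.

Let mu_gt0 : 0 < mu. Proof. have := c_lt1; lra. Qed.

Let mu_lt1 : mu < 1. Proof. have := c_gt0; lra. Qed.

Let Tw : T w = mu *: w. Proof. by apply/eqP; rewrite -mem_leigenspace. Qed.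

(** Projecting [PA w + PB w = (1 - c) w] onto [A] and onto [B] shows that [PA] and
   [PB] exchange the two components up to the factor [- c]; all facts about [w]
   follow from these three equations. *)
Let sum_proj : PA w + PB w = (1 - c) *: w.
Proof.
have : 2 *: T w = (2 * mu) *: w by rewrite Tw scalerA.
rewrite avgprojE scalerA divff ?pnatr_eq0// scale1r => ->; congr (_ *: _).
by field.
Qed.

Let PA_PB : PA (PB w) = - c *: PA w.
Proof.
have := congr1 PA sum_proj; rewrite linearD linearZ/= oproj_idem.
move/(canRL (addKr _)) => ->.
by rewrite scalerBl scale1r addrA addNr add0r scaleNr.
Qed.

Let PB_PA : PB (PA w) = - c *: PB w.
Proof.
have := congr1 PB sum_proj; rewrite addrC linearD linearZ/= oproj_idem.
move/(canRL (addKr _)) => ->.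
by rewrite scalerBl scale1r addrA addNr add0r scaleNr.
Qed.

(** The inner product of [PA w] and [PB w] is [- c |PA w|^2] and also
    [- c |PB w|^2], so both components have the same norm; then expand
    [|PA w + PB w|^2 = (1 - c)^2 |w|^2]. *)
Lemma sqr_ipnorm_oproj_eig : nrm (PA w) ^+ 2 = mu * nrm w ^+ 2.
Proof.
have E1 : '[PA w, PB w] = - c * nrm (PA w) ^+ 2.
  by rewrite sqr_ipnorm -ipZr -PA_PB -(oproj_sym ip A) oproj_idem.
have E2 : '[PA w, PB w] = - c * nrm (PB w) ^+ 2.
  by rewrite sqr_ipnorm -ipZl -PB_PA (oproj_sym ip B) oproj_idem.
have E : nrm (PA w) ^+ 2 = nrm (PB w) ^+ 2.
  have cN0 : - c != 0 by rewrite oppr_eq0 gt_eqF.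
  by apply: (mulfI cN0); rewrite -E1.
have := congr1 (fun z => '[z, z]) sum_proj => /=.
rewrite ipDl !ipDr (ipC ip (PB w) (PA w)) ipZl ipZr -!sqr_ipnorm E1 -E.
have c1 : 1 - c != 0 by rewrite subr_eq0 gt_eqF.
by move=> H; apply: (mulfI c1); nra.
Qed.

Lemma oproj_eig_neq0 : PA w != 0.
Proof.
rewrite -(ipnorm_eq0 ip) -sqrf_eq0 sqr_ipnorm_oproj_eig mulf_eq0 sqrf_eq0.
by rewrite ipnorm_eq0 (negbTE w0) orbF; rewrite gt_eqF.
Qed.

(** [A :&: B] consists of eigenvectors of [T] for the eigenvalue 1. *)
Lemma oproj_cap_eig : oproj ip (A :&: B) w = 0.
Proof.
apply: oproj_eq0; apply/orthov_memP => v /memv_capP[vA vB].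
apply: (@leigenspace_orth _ _ _ T mu 1); first exact: avgproj_sym.
- exact: Tw.
- rewrite avgprojE (oproj_id ip vA) (oproj_id ip vB) scalerDr -scalerDl.
  by congr (_ *: _); field.
- by rewrite lt_eqF.
Qed.

Lemma iter_alt_eig k : iter k.+1 U w = (- c * (c ^+ 2) ^+ k) *: PA w.
Proof.
elim: k => [|k IH]; first by rewrite /= comp_lfunE PA_PB expr0 mulr1.
rewrite iterS IH linearZ/= comp_lfunE PB_PA linearZ/= PA_PB !scalerA.
by congr (_ *: _); rewrite [_ ^+ k.+1]exprS; ring.
Qed.

Lemma alt_err_eig k :
  alt_err ip A B w k.+1 = c * (c ^+ 2) ^+ k * nrm (PA w).
Proof.
rewrite /alt_err oproj_cap_eig subr0 iter_alt_eig ipnormZ mulNr normrN.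
by rewrite ger0_norm// mulr_ge0// ?exprn_ge0// ltW.
Qed.

Lemma avg_err_eig k : avg_err ip A B w k = mu ^+ k * nrm w.
Proof.
rewrite /avg_err oproj_cap_eig subr0.
have -> : iter k T w = mu ^+ k *: w.
  elim: k => [|k IH]; first by rewrite expr0 scale1r.
  by rewrite iterS IH linearZ/= Tw scalerA exprSr.
by rewrite ipnormZ ger0_norm// exprn_ge0// ltW.
Qed.

Lemma alt_err_eig_gt0 k : 0 < alt_err ip A B w k.+1.
Proof. by rewrite alt_err_eig !mulr_gt0 ?exprn_gt0// ipnorm_gt0 oproj_eig_neq0. Qed.

Lemma sqr_alt_err_eig k :
  alt_err ip A B w k.+1 ^+ 2 = (c ^+ 2) ^+ (2 * k.+1 - 1) * mu * nrm w ^+ 2.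
Proof.
rewrite alt_err_eig exprMn sqr_ipnorm_oproj_eig mulrA; congr (_ * _ * _).
rewrite [LHS]exprMn.
rewrite (_ : 2 * k.+1 - 1 = (k * 2).+1)%N; last by rewrite mulnS subn1 mulnC.
by rewrite [RHS]exprS [in RHS]exprM.
Qed.

Lemma limn_alt_eig : limn (quotients (alt_err ip A B w)) = c ^+ 2.
Proof.
apply: limn_quotients_cst => k; first exact: alt_err_eig_gt0.
by rewrite !alt_err_eig [_ ^+ k.+1]exprS; ring.
Qed.

Lemma limn_avg_eig : limn (quotients (avg_err ip A B w)) = mu.
Proof.
apply: limn_quotients_cst => k; rewrite !avg_err_eig.
  by rewrite mulr_gt0 ?ipnorm_gt0// exprn_gt0.
by rewrite [mu ^+ k.+2]exprS mulrA.
Qed.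

Lemma eigenvalues_at_avg_eig : eigenvalues_at ip w T = [set mu].
Proof. exact: eigenvalues_at1 (avgproj_sym ip A B) Tw w0. Qed.

(** [PB PA PB] maps both [w] and [PB w] to [c ^+ 2 *: PB w], so that
    [w = (w - PB w) + PB w] is the decomposition into eigenvectors. *)
Lemma eigenvalues_at_alt_eig : eigenvalues_at ip w S = [set 0; c ^+ 2].
Proof.
have SE x : S x = PB (PA (PB x)) by rewrite !comp_lfunE.
have PBAB : PB (PA (PB w)) = c ^+ 2 *: PB w.
  by rewrite PA_PB linearZ/= PB_PA scalerA mulrNN -expr2.
rewrite -[X in eigenvalues_at _ X _](subrK (PB w)); apply: eigenvalues_at2.
- by move=> x y; rewrite !SE !oproj_sym.
- by rewrite eq_sym expf_neq0// gt_eqF.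
- by rewrite scale0r SE !linearB/= oproj_idem subrr.
- by rewrite SE oproj_idem.
- rewrite subr_eq0; apply/eqP => wB; apply: (negP oproj_eig_neq0).
  have := PA_PB; rewrite -wB => /eqP.
  rewrite -subr_eq0 -{1}[PA w]scale1r -scalerBl opprK scaler_eq0.
  by case/orP => // /eqP; have := c_gt0; lra.
- apply: contraNneq w0 => q0; move: PA_PB; rewrite q0 linear0 => /eqP.
  by rewrite eq_sym scaler_eq0 oppr_eq0 gt_eqF//= (negbTE oproj_eig_neq0).
Qed.

End LeastEigenvalue.

(** * Comparison of the two rates *)

Theorem mainTheorem2 (R : realType) (d : nat) (ip : {dot 'rV[R]_d for idfun})
    (A B : {vspace 'rV[R]_d})
    (hA0 : A != 0%VS) (hA1 : A != fullv)
    (hB0 : B != 0%VS) (hB1 : B != fullv) :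
  let theta := friedrichs_angle ip A B in
  let c := cos theta in
  let PA := oproj ip A in
  let PB := oproj ip B in
  let T := avgproj ip A B in
  let E := passmx.leigenspace T (1 / 2 - 1 / 2 * c) in
  let a_err := alt_err ip A B in
  let x_err := avg_err ip A B in
  let lambda := fun x : 'rV[R]_d => limn (quotients (a_err x)) in
  let mu := fun x : 'rV[R]_d => limn (quotients (x_err x)) in
  (* the quotients and their limits lambda, mu are well defined *)
  (forall x : 'rV[R]_d, 0 < a_err x 1%N ->
     [/\ (forall k : nat, (1 <= k)%N -> 0 < a_err x k /\ 0 < x_err x k),
         cvgn (quotients (a_err x)) & cvgn (quotients (x_err x))])
  /\
  (* (i) *)
  ((pi / 3 < theta <-> c < 1 / 2) /\
   (pi / 3 < theta ->
    forall x : 'rV[R]_d, 0 < a_err x 1%N ->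
      [/\ mu x >= 1 / 2 - 1 / 2 * c,
          1 / 2 - 1 / 2 * c > c ^+ 2,
          c ^+ 2 >= lambda x &
          exists k0 : nat, forall k : nat, (k0 <= k)%N -> x_err x k > a_err x k]))
  /\
  (* (ii) *)
  ((theta < pi / 3 <-> 1 / 2 < c) /\
   (theta < pi / 3 ->
    (exists w : 'rV[R]_d, w \in E /\ w != 0) /\
    forall w : 'rV[R]_d, w \in E -> w != 0 ->
      0 < a_err w 1%N /\
      eigenvalues_at ip w T = [set 1 / 2 - 1 / 2 * c] /\
      eigenvalues_at ip w (PB \o PA \o PB)%VF = [set 0; c ^+ 2] /\
      [/\ mu w = 1 / 2 - 1 / 2 * c,
          1 / 2 - 1 / 2 * c < c ^+ 2 &
          c ^+ 2 = lambda w] /\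
      forall k : nat, (1 <= k)%N ->
        [/\ a_err w k ^+ 2 = lambda w ^+ (2 * k - 1) * mu w * ipnorm ip w ^+ 2,
            lambda w ^+ (2 * k - 1) * mu w * ipnorm ip w ^+ 2
              > mu w ^+ (2 * k) * ipnorm ip w ^+ 2 &
            mu w ^+ (2 * k) * ipnorm ip w ^+ 2 = x_err w k ^+ 2]))
  /\
  (* boundary case *)
  (c = 1 / 2 ->
   forall w : 'rV[R]_d, w \in E -> w != 0 ->
     [/\ 0 < a_err w 1%N,
         lambda w = mu w &
         forall k : nat, (1 <= k)%N -> a_err w k = x_err w k]).
Proof.
move=> theta c PA PB T E a_err x_err lambda mu.
have w0 : vpick A != 0 by rewrite vpick0.
have [theta_int cS cU] := friedrichs_angleP ip A B w0.
rewrite -/theta -/c in theta_int cS cU.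
have [tgt tlt] := cos_lt_half theta_int.
rewrite -/c in tgt tlt.
have c_ge0 : 0 <= c.
  apply: cos_ge0_pihalf; have /andP[t0 ->] := theta_int; rewrite andbT.
  by rewrite (le_trans _ t0)// oppr_le0 divr_ge0// pi_ge0.
have c_lt1 : c < 1.
  by rewrite lt_neqAle (friedrichs_neq1 cS) cos_le1.
have cb := friedrichs_cosine_bound cU.
have a_gt0 x : 0 < a_err x 1%N -> forall k, 0 < a_err x k.+1.
  by move=> x0 k; exact: alt_err_gt0.
have x_gt0 x : 0 < a_err x 1%N -> forall k, 0 < x_err x k.+1.
  by move=> x0 k; exact: avg_err_gt0.
have c_half : 1 / 2 < c -> 0 < c < 1.
  by move=> ch; rewrite c_lt1 andbT; lra.
split; [|split; [|split]].
- move=> x x0; split.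
  + by case=> // k _; split; [exact: a_gt0|exact: x_gt0].
  + exact: cvgn_alt_quotients.
  + exact: cvgn_avg_quotients.
- rewrite tgt; split => // cl x x0.
  have gap : c ^+ 2 < 1 / 2 - 1 / 2 * c by nra.
  have al := alt_err_le c_ge0 cb x; have xl := avg_err_ge c_ge0 cb c_lt1 x.
  split => //.
  + apply: limn_quotients_ge => //; first exact: x_gt0.
    exact: cvgn_avg_quotients.
  + apply: limn_quotients_le => //; first exact: a_gt0.
    exact: cvgn_alt_quotients.
  + apply: (geometric_lt _ al xl); last exact: x_gt0.
    by rewrite sqr_ge0.
- rewrite tlt; split => // cl; have c01 := c_half cl.
  have c_gt0 : 0 < c by lra.
  split; first exact: friedrichs_eigenvector c_gt0 cS cb.
  move=> w wE wn0; have gap : 1 / 2 - 1 / 2 * c < c ^+ 2 by nra.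
  have mu_gt0 : 0 < 1 / 2 - 1 / 2 * c by lra.
  have lE : lambda w = c ^+ 2 := limn_alt_eig c01 wE wn0.
  have mE : mu w = 1 / 2 - 1 / 2 * c := limn_avg_eig c01 wE wn0.
  split; first exact: alt_err_eig_gt0 c01 wE wn0 0.
  split; first exact: eigenvalues_at_avg_eig wE wn0.
  split; first exact: eigenvalues_at_alt_eig c01 wE wn0.
  split; first by split.
  case=> // k _; rewrite lE mE; split.
  + exact: sqr_alt_err_eig c01 wE k.
  + rewrite ltr_pM2r ?exprn_gt0 ?ipnorm_gt0// subn1.
    rewrite -[X in _ ^+ X < _]prednK// exprSr ltr_pM2r//.
    by rewrite ltrXn2r ?nnegrE ?sqr_ge0 ?ltW// mulnS.
  + by rewrite [x_err _ _](avg_err_eig c01 wE) exprMn -exprM mulnC.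
- move=> ch w wE wn0; have c01 : 0 < c < 1 by rewrite ch; lra.
  have gap : 1 / 2 - 1 / 2 * c = c ^+ 2 by rewrite ch; field.
  split; first exact: alt_err_eig_gt0 c01 wE wn0 0.
  + by rewrite /lambda /mu (limn_alt_eig c01 wE wn0) (limn_avg_eig c01 wE wn0).
  + case=> // k _; apply/eqP.
    rewrite -(@eqrXn2 _ 2) ?ipnorm_ge0// /a_err (sqr_alt_err_eig c01 wE) /x_err.
    rewrite (avg_err_eig c01 wE) gap; apply/eqP.
    rewrite [RHS]exprMn; congr (_ * _).
    by rewrite -exprSr subn1 prednK// mulnC exprM.
Qed.
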